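(* Let $A=(a_n)_{n\ge1}$ be a strictly ascending sequence of non-negative integers and let $\mathfrak{n}(A)=\prod_{n\ge1}a_n$. Then for every generalized integer $\mathfrak{m}$ coprime with $\mathfrak{n}(A)$ there exists a simple Riesz group of rank one $G(\mathfrak{m})$ such that: (i) there is an unbounded countably generated interval $D\subseteq G(\mathfrak{m})^+$ with $nD\neq G(\mathfrak{m})^+$ for all $n\in\mathbb{N}$; (ii) for some generalized integer $\mathfrak{n}$ dividing $\mathfrak{n}(A)$, $G(\mathfrak{m})$ is isomorphic, as an abelian group, to $\mathbb{Z}_{\mathfrak{n}\cdot\mathfrak{m}}$.
   Context: Partially ordered abelian group $(G,G^+)$; simple: $G\neq0$ and every nonzero $u\in G^+$ is an order-unit. Riesz group: $x\le y_1+y_2$ in $G^+$ implies $x=x_1+x_2$ with $x_j\in G^+$, $x_j\le y_j$. Rank one: isomorphic to a nonzero subgroup of $\mathbb{Q}$. Generalized integers: maps from primes to $\{0,1,\dots,\infty\}$, products add exponents, $\prod_n a_n$ has at each prime the sum of the exponents in the $a_n$; $\mathfrak{n}\mid\mathfrak{m}$ if $\mathfrak{m}=\mathfrak{n}\mathfrak{n}'$; coprime: at each prime one exponent is $0$. $\mathbb{Z}_{\mathfrak{n}}=\{a/b\in\mathbb{Q}: b\mid\mathfrak{n}\}$. An interval in $G^+$ is a nonempty, upward directed, order-hereditary subset of $G^+$; countably generated if it has a countable cofinal subset; $nD$ is the set of $z\in G^+$ with $z\le x_1+\dots+x_n$ for some $x_i\in D$. $D$ is unbounded if for an order-unit $u$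 and every state $s$ on $(G,u)$ (positive homomorphism to $\mathbb{R}$ with $s(u)=1$), $\sup_{x\in D}s(x)=\infty$. *)

(* Defs.v *)
From Stdlib Require Import Reals ClassicalEpsilon.
From mathcomp Require Import all_boot all_algebra.
Set Implicit Arguments. Unset Strict Implicit. Unset Printing Implicit Defensive.
Import GRing.Theory.
Local Open Scope ring_scope.

(* A generalized integer: exponent at each prime p, in {0,1,...} u {oo}
   (None = oo). Values at non-primes are ignored by all notions below. *)
Definition gint := nat -> option nat.

Definition eadd (x y : option nat) : option nat :=
  match x, y with Some a, Some b => Some (a + b)%N | _, _ => None end.

Definition gmul (n m : gint) : gint := fun p => eadd (n p) (m p).

(* an ordinary natural number as a generalized integer;
   convention: 0 is divisible by every prime power (exponent oo everywhere) *)
Definition gint_of_nat (a : nat) : gint :=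
  fun p => if a == 0%N then None else Some (logn p a).

Definition gpsum (a : nat -> gint) (p N : nat) : option nat :=
  foldr (fun i acc => eadd (a i p) acc) (Some 0%N) (iota 0 N).

(* infinite product: the exponent at p is the (extended) sum of exponents *)
Definition gprod (a : nat -> gint) : gint := fun p =>
  match excluded_middle_informative
          (exists k : nat, exists N0 : nat, forall N : nat, (N0 <= N)%N -> gpsum a p N = Some k) with
  | left H => Some (proj1_sig (constructive_indefinite_description _ H))
  | right _ => None
  end.

Definition gdvd (n m : gint) : Prop :=
  exists n' : gint, forall p, prime p -> m p = eadd (n p) (n' p).

Definition gcoprime (n m : gint) : Prop :=
  forall p, prime p -> n p = Some 0%N \/ m p = Some 0%N.

Definition Zgen (n : gint) (q : rat) : Prop :=
  exists (a : int) (b : nat), (0 < b)%N /\ gdvd (gint_of_nat b) n /\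
    q = a%:~R / b%:R.

Definition po_cone (G : zmodType) (P : G -> Prop) : Prop :=
  P 0 /\ (forall x y, P x -> P y -> P (x + y)) /\
  (forall x, P x -> P (- x) -> x = 0).

Definition pleq (G : zmodType) (P : G -> Prop) (x y : G) : Prop := P (y - x).

Definition order_unit (G : zmodType) (P : G -> Prop) (u : G) : Prop :=
  P u /\ forall x, exists n : nat, pleq P x (u *+ n).

Definition simple_pog (G : zmodType) (P : G -> Prop) : Prop :=
  (exists x : G, x != 0) /\ forall u, P u -> u != 0 -> order_unit P u.

Definition riesz (G : zmodType) (P : G -> Prop) : Prop :=
  forall x y1 y2, P x -> P y1 -> P y2 -> pleq P x (y1 + y2) ->
  exists x1 x2, [/\ P x1, P x2, pleq P x1 y1, pleq P x2 y2 & x = x1 + x2].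

Definition additive_map (G H : zmodType) (f : G -> H) : Prop :=
  forall x y, f (x + y) = f x + f y.

Definition rank_one (G : zmodType) : Prop :=
  exists f : G -> rat, additive_map f /\ injective f /\ exists x, f x != 0.

Definition is_interval (G : zmodType) (P D : G -> Prop) : Prop :=
  [/\ (exists x, D x),
      (forall x, D x -> P x),
      (forall x y, D x -> D y -> exists z, [/\ D z, pleq P x z & pleq P y z]) &
      (forall x y, P y -> pleq P y x -> D x -> D y)].

Definition countably_generated (G : zmodType) (P D : G -> Prop) : Prop :=
  exists c : nat -> G, (forall k, D (c k)) /\
    forall x, D x -> exists k, pleq P x (c k).

Definition multD (G : zmodType) (P D : G -> Prop) (n : nat) (z : G) : Prop :=
  P z /\ exists xs : 'I_n -> G, (forall i, D (xs i)) /\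
    pleq P z (\sum_(i < n) xs i).

Definition is_state (G : zmodType) (P : G -> Prop) (u : G) (s : G -> R) : Prop :=
  (forall x y, s (x + y) = Rplus (s x) (s y)) /\
  (forall x, P x -> Rle R0 (s x)) /\ s u = R1.

Definition unbounded (G : zmodType) (P D : G -> Prop) : Prop :=
  exists u, order_unit P u /\
    forall s, is_state P u s -> forall M : R, exists x, D x /\ Rlt M (s x).

(* Main.v *)
Require Import Defs.
From Stdlib Require Import Reals ClassicalEpsilon.
From HB Require Import structures.
From mathcomp Require Import all_boot all_order all_algebra.
From mathcomp Require Import lra ring zify.
Set Implicit Arguments. Unset Strict Implicit. Unset Printing Implicit Defensive.
Import Order.TTheory GRing.Theory Num.Theory.
Local Open Scope ring_scope.

(* The cone is built inside Q as an increasing union of cones P_k of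
   nonnegative elements of an increasing tower of subgroups G_k, each P_k
   containing all sufficiently large elements of G_k; this makes the union simple.
   An unsolved refinement x + t = y1 + y2 in P_k is solved by adjoining z, x - z,
   y1 - z and t - y1 + z, where z is a rational in the admissible open interval
   whose order modulo G_k is huge: an element of G_k that becomes positive is then
   either large already, or a combination in which z cancels, hence already in P_k.
   So each step is an order embedding and the union is a Riesz group.  Interleaved
   with these steps, the chain d_0 <= d_1 <= ... generating D is extended by
   d_(k+1) = d_k + z with a fresh z of huge order: if n d_(k+1) - N is positive
   then z must cancel, so n d_k - N was positive, and going down to d_n one gets
   a contradiction as soon as N > n d_n.
   The denominators of the G_k are products of the a_i with i >= 2; they are
   coprime to m, which provides elements of huge order. *)

(** * Dependent choice, subgroups of [rat] as types, recurrent enumerations *)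

Lemma dependent_choice (T : Type) (I : T -> Prop) (R : nat -> T -> T -> Prop) (t0 : T) :
  I t0 -> (forall k t, I t -> exists t', I t' /\ R k t t') ->
  exists f : nat -> T, f 0%N = t0 /\ forall k, I (f k) /\ R k (f k) (f k.+1).
Proof.
move=> I0 step.
pose next k t := epsilon (inhabits t0) (fun t' => I t' /\ R k t t').
pose f := fix f k := if k is j.+1 then next j (f j) else t0.
have fI k : I (f k).
  elim: k => // k IH.
  by case: (epsilon_spec (inhabits t0) (fun t' => I t' /\ R k (f k) t') (step k _ IH)).
exists f; split=> // k; split=> //.
by case: (epsilon_spec (inhabits t0) (fun t' => I t' /\ R k (f k) t') (step k _ (fI k))).
Qed.

Record zsubgroup (S : zmodClosed rat) := ZSubgroup { zsub_val : rat; _ : zsub_val \in S }.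
HB.instance Definition _ (S : zmodClosed rat) := [isSub for @zsub_val S].
HB.instance Definition _ (S : zmodClosed rat) := [Choice of zsubgroup S by <:].
HB.instance Definition _ (S : zmodClosed rat) :=
  [SubChoice_isSubZmodule of zsubgroup S by <:].

(** Excluded middle turns the subgroup into a boolean predicate, whose subtype inherits the group
    structure of [rat]. *)
Lemma subgroup_zmodType (H : rat -> Prop) :
  H 0 -> (forall x y, H x -> H y -> H (x - y)) ->
  exists (U : zmodType) (f : {additive U -> rat}),
    injective f /\ forall q, H q <-> exists x, f x = q.
Proof.
move=> H0 HB.
pose p : pred rat := fun q => if excluded_middle_informative (H q) then true else false.
have pP q : reflect (H q) (q \in p).
  by rewrite unfold_in /p; case: excluded_middle_informative => h; constructor.
have pB : zmod_closed p.
  by split; [apply/pP | move=> x y /pP Hx /pP Hy; apply/pP; apply: HB].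
pose S : zmodClosed rat := HB.pack p (GRing.isZmodClosed.Build rat p pB).
exists (zsubgroup S), (val : {additive zsubgroup S -> rat}); split; first exact: val_inj.
move=> q; split=> [/pP Hq|[x <-]]; first by exists (ZSubgroup (S := S) Hq).
by apply/pP; exact: (valP x).
Qed.

(* The 2-adic valuation takes each value infinitely often. *)
Lemma exists_recurrent_enumeration (T : countType) (t0 : T) :
  exists e : nat -> T, forall t K, exists k, (K <= k)%N /\ e k = t.
Proof.
exists (fun k => odflt t0 (unpickle (logn 2 k.+1))) => t K.
exists (2 ^ pickle t * (2 * K).+1).-1.
have n0 : (0 < 2 ^ pickle t * (2 * K).+1)%N by rewrite muln_gt0 expn_gt0.
split; first by rewrite -ltnS prednK //; apply: leq_trans (leq_pmull _ _); rewrite ?expn_gt0 //; lia.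
rewrite prednK // lognM ?expn_gt0 // pfactorK // logn_coprime ?addn0 ?pickleK //.
by rewrite coprime2n /= mul2n odd_double.
Qed.

(** For a subgroup [H]: the order of [z] modulo [H] is at least [T]. Two natural coefficients are
    compared because multiples of [z] arise with both signs in [extension]. *)
Definition large_order (H : rat -> Prop) (T : nat) (z : rat) : Prop :=
  forall i j : nat, H (z * i%:R - z * j%:R) -> [\/ i = j, (i + T <= j)%N | (j + T <= i)%N].

(** * Extending a cone along a tower of subgroups of [rat] *)

Section Tower.
Variable G : nat -> rat -> Prop.
Hypothesis G_nat : forall s n, G s n%:R.
Hypothesis GD : forall s x y, G s x -> G s y -> G s (x + y).
Hypothesis GN : forall s x, G s x -> G s (- x).
Hypothesis G_mono : forall s t x, (s <= t)%N -> G s x -> G t x.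
Hypothesis G_large_order : forall s T (lo hi : rat), lo < hi ->
  exists s' z, [/\ (s < s')%N, G s' z, lo < z, z < hi & large_order (G s) T z].

Lemma GB s x y : G s x -> G s y -> G s (x - y).
Proof. by move=> Gx Gy; apply: GD => //; apply: GN. Qed.

Lemma GM s x n : G s x -> G s (x * n%:R).
Proof.
move=> Gx; elim: n => [|n IH]; first by rewrite mulr0; apply: (G_nat s 0).
by rewrite -natr1 mulrDr mulr1; apply: GD.
Qed.

Definition stage_cone (s : nat) (P : rat -> Prop) : Prop :=
  [/\ P 0, (forall x y, P x -> P y -> P (x + y)),
      (forall x, P x -> G s x /\ 0 <= x) &
      exists L : rat, forall x, G s x -> L <= x -> P x].

Lemma coneM s P x n : stage_cone s P -> P x -> P (x * n%:R).
Proof.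
case=> P0 PD _ _ Px; elim: n => [|n IH]; first by rewrite mulr0.
by rewrite -natr1 mulrDr mulr1; apply: PD.
Qed.

(** The bounds on [lo] and [hi] make the four adjoined elements positive for every [z] strictly
    between them. The last clause serves two purposes: with [n = 0] it is the order embedding used
    for refinements; with [x = y2] the fourth adjoined element is [z] itself, and coefficients up to
    [K] are allowed when the chain is extended. *)
Lemma extension s P x y1 y2 lo hi (K : nat) (M : rat) :
  stage_cone s P -> P x -> P y1 -> P y2 -> P (y1 + y2 - x) ->
  0 <= lo -> x - y2 <= lo -> hi <= x -> hi <= y1 -> lo < hi ->
  exists s' P' z, [/\ (s < s')%N, stage_cone s' P', (forall p, P p -> P' p) & lo < z] /\
    [/\ P' z, P' (x - z), P' (y1 - z), P' (y2 - x + z) &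
      forall n w, (n <= K)%N -> n = 0%N \/ x = y2 -> G s w -> w + z * n%:R <= M ->
        P' (w + z * n%:R) -> P w].
Proof.
move=> cP Px Py1 Py2 Pt lo0 lo1 hi0 hi1 lohi.
have [P0 PD PG [L PL]] := cP.
(* A third of the gap keeps all four adjoined elements above [e] and still leaves an open interval
   of length [e] for [z]. *)
pose e := (hi - lo) / 3%:R.
have e0 : 0 < e by rewrite /e; lra.
have [T0 hT0] : exists T0 : nat, M / e < T0%:R.
  by exists (Num.truncn `|M / e|).+1; apply: le_lt_trans (ler_norm _) (truncnS_gt _).
have hT : M < T0%:R * e by rewrite -ltr_pdivrMr.
have [s' [z [ss' Gz zlo zhi zT]]] :
    exists s' z, [/\ (s < s')%N, G s' z, lo + e < z, z < hi - e & large_order (G s) (T0 + K)%N z].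
  by apply: G_large_order; rewrite /e; lra.
have z11 : e <= z by lra.
have z12 : e <= x - z by lra.
have z21 : e <= y1 - z by lra.
have z22 : e <= y2 - x + z by lra.
have inG q : P q -> G s' q by move=> /PG[Gq _]; apply: G_mono Gq; apply: ltnW.
(* Adding all elements above [`|M| + 1] keeps the cone cofinite in the larger group. *)
pose gen g := exists p (a b c d : nat), P p /\
  g = p + z * a%:R + (x - z) * b%:R + (y1 - z) * c%:R + (y2 - x + z) * d%:R.
pose P' g := [/\ G s' g, 0 <= g & (`|M| + 1 <= g \/ gen g)].
have Gx := inG _ Px; have Gy1 := inG _ Py1; have Gy2 := inG _ Py2.
have gP p a b c d : P p ->
    P' (p + z * a%:R + (x - z) * b%:R + (y1 - z) * c%:R + (y2 - x + z) * d%:R).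
  move=> Pp; split; last by right; exists p, a, b, c, d.
    have Gpz := GD (inG _ Pp) (GM a Gz).
    have Gb := GM b (GB Gx Gz); have Gc := GM c (GB Gy1 Gz).
    by have Gd := GM d (GD (GB Gy2 Gx) Gz); exact: GD (GD (GD Gpz Gb) Gc) Gd.
  have [_ p0] := PG _ Pp.
  by rewrite !addr_ge0 // mulr_ge0 ?ler0n //; lra.
exists s', P', z; split; [split|split] => //.
- split.
  + by have := gP 0 0%N 0%N 0%N 0%N P0; rewrite !mulr0 !addr0.
  + move=> g h [Gg g0 Hg] [Gh h0 Hh]; split; [exact: GD | exact: addr_ge0 |].
    case: Hg => [Hg|[p [a [b [c [d [Pp defg]]]]]]]; first by left; lra.
    case: Hh => [Hh|[p' [a' [b' [c' [d' [Pp' defh]]]]]]]; first by left; lra.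
    right; exists (p + p'), (a + a')%N, (b + b')%N, (c + c')%N, (d + d')%N.
    by split; [exact: PD | rewrite defg defh !natrD; ring].
  + by move=> g [].
  + exists (`|M| + 1) => g Gg Lg; split=> //; last by left.
    by have := normr_ge0 M; lra.
- by move=> p Pp; have := gP p 0%N 0%N 0%N 0%N Pp; rewrite !mulr0 !addr0.
- by lra.
- by have := gP 0 1%N 0%N 0%N 0%N P0; rewrite !mulr0 !addr0 add0r mulr1.
- by have := gP 0 0%N 1%N 0%N 0%N P0; rewrite !mulr0 !addr0 add0r mulr1.
- by have := gP 0 0%N 0%N 1%N 0%N P0; rewrite !mulr0 !addr0 add0r mulr1.
- by have := gP 0 0%N 0%N 0%N 1%N P0; rewrite !mulr0 !addr0 add0r mulr1.
move=> n w nK cas Gw wM [_ _ [big|[p [a [b [c [d [Pp def]]]]]]]].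
  by have := ler_norm M; lra.
have [_ p0] := PG _ Pp.
have lower i : (T0 <= i)%N -> M < e * i%:R.
  move=> Ti; apply: lt_le_trans hT _; rewrite mulrC ler_pM2l // ler_nat //.
have term u i : e <= u -> e * i%:R <= u * i%:R by move=> eu; rewrite ler_wpM2r // ler0n.
have en i : 0 <= e * i%:R by rewrite mulr_ge0 ?ler0n ?ltW.
have key : z * (n + b + c)%:R - z * (a + d)%:R =
    p + x * b%:R + y1 * c%:R + (y2 - x) * d%:R - w.
  by rewrite !natrD; lra.
have Gq q : P q -> G s q by case/PG.
have : G s (z * (n + b + c)%:R - z * (a + d)%:R).
  rewrite key; apply: GB => //; have Gb := GM b (Gq _ Px); have Gc := GM c (Gq _ Py1).
  by have Gd := GM d (GB (Gq _ Py2) (Gq _ Px)); have Gp := Gq _ Pp; exact: GD (GD (GD Gp Gb) Gc) Gd.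
(* Either [z] cancels, or one of [a + d], [b + c] is at least [T0], the summand [K] of the order
   absorbing [n]. In the latter case the element is at least [e * T0], hence above [M]. *)
case/zT => [eq|le1|le2].
- have PM u i : P u -> P (u * i%:R) := coneM i cP.
  have defw : w = p + x * b%:R + y1 * c%:R + (y2 - x) * d%:R.
    by apply/eqP; rewrite eq_sym -subr_eq0 -key eq subrr.
  case: cas => [n0|xy]; last first.
    by rewrite defw xy subrr mul0r addr0 -xy; exact: (PD _ _ (PD _ _ Pp (PM _ b Px)) (PM _ c Py1)).
  (* Now [b + c = a + d]. Each negative [x] coming from [d] is offset by an [x] from [b]; any excess
     [d - b] is at most [c] and is paired with copies of [y1] to form [y1 + y2 - x]. *)
  have [db|bd] := leqP d b.
    have -> : w = p + x * (b - d)%:R + y1 * c%:R + y2 * d%:R by rewrite defw natrB //; ring.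
    exact: (PD _ _ (PD _ _ (PD _ _ Pp (PM _ _ Px)) (PM _ _ Py1)) (PM _ _ Py2)).
  have -> : w = p + y1 * (c - (d - b))%:R + y2 * b%:R + (y1 + y2 - x) * (d - b)%:R.
    have dbc : (d - b <= c)%N by move: eq n0; clear; lia.
    by rewrite defw natrB // natrB ?(ltnW bd) //; ring.
  exact: (PD _ _ (PD _ _ (PD _ _ Pp (PM _ _ Py1)) (PM _ _ Py2)) (PM _ _ Pt)).
- have : M < e * (a + d)%:R by apply: lower; move: le1 nK; clear; lia.
  rewrite natrD mulrDr; have := term _ a z11; have := term _ b z12.
  have := term _ c z21; have := term _ d z22; have := en b; have := en c; lra.
- have : M < e * (b + c)%:R by apply: lower; move: le2 nK; clear; lia.
  rewrite natrD mulrDr; have := term _ a z11; have := term _ b z12.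
  have := term _ c z21; have := term _ d z22; have := en a; have := en d; lra.
Qed.

(* [x1], [x - x1], [y1 - x1], [y2 - x + x1] is the refinement matrix of
   [x + (y1 + y2 - x) = y1 + y2]. *)
Definition splits (P P' : rat -> Prop) (x y1 y2 : rat) : Prop :=
  P x -> P y1 -> P y2 -> P (y1 + y2 - x) ->
  exists x1, [/\ P' x1, P' (x - x1), P' (y1 - x1) & P' (y2 - x + x1)].

(** A problem already solved in [P] leaves the stage unchanged, whence only [s <= s']; otherwise
    [extension] adjoins a solution. *)
Lemma refine_step s P x y1 y2 : stage_cone s P ->
  exists s' P', [/\ (s <= s')%N, stage_cone s' P', (forall p, P p -> P' p),
    (forall w, G s w -> P' w -> P w) & splits P P' x y1 y2].
Proof.
move=> cP; have [P0 PD PG [L PL]] := cP.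
have [sp|nsp] := excluded_middle_informative (splits P P x y1 y2); first by exists s, P.
have [Px [Py1 [Py2 Pt]]] : P x /\ P y1 /\ P y2 /\ P (y1 + y2 - x).
  by apply: NNPP => H; apply: nsp => px p1 p2 pt; case: H.
have {}nsp : ~ exists x1, [/\ P x1, P (x - x1), P (y1 - x1) & P (y2 - x + x1)].
  by move=> H; apply: nsp.
have [_ x0] := PG _ Px; have [_ y10] := PG _ Py1.
have [_ y20] := PG _ Py2; have [_ t0] := PG _ Pt.
(* If one of [x], [y1], [y2], [y1 + y2 - x] vanishes, a refinement exists inside [P]. So all four
   are positive, which is exactly what makes max(0, [x - y2]) < min([x], [y1]). *)
have xN0 : x <> 0.
  by move=> e; apply: nsp; exists 0; split; rewrite ?e ?subr0 ?addr0.
have y1N0 : y1 <> 0.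
  move=> e; apply: nsp; exists 0; split; rewrite ?subr0 ?addr0 //.
  by move: Pt; rewrite e add0r.
have y2N0 : y2 <> 0.
  move=> e; apply: nsp; exists x; split; rewrite ?subrr ?addrNK //.
  by move: Pt; rewrite e addr0.
have tN0 : y1 + y2 - x <> 0.
  move=> e; apply: nsp; exists y1; split; rewrite ?subrr //.
    by have -> : x - y1 = y2 by lra.
  by have -> : y2 - x + y1 = 0 by lra.
have pos (u : rat) : 0 <= u -> u <> 0 -> 0 < u by move=> u0 /eqP uN; rewrite lt_neqAle eq_sym uN.
have {xN0} x0 := pos _ x0 xN0; have {y10 y1N0} y10 := pos _ y10 y1N0.
have {y20 y2N0} y20 := pos _ y20 y2N0; have {t0 tN0} t0 := pos _ t0 tN0.
have [lo [lo0 lo1 lox loy]] : exists lo, [/\ 0 <= lo, x - y2 <= lo, lo < x & lo < y1].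
  by have [le|lt] := lerP 0 (x - y2); [exists (x - y2)|exists 0]; split; lra.
have [hi [hix hiy lohi]] : exists hi, [/\ hi <= x, hi <= y1 & lo < hi].
  by have [le|lt] := lerP x y1; [exists x|exists y1]; split; lra.
(* Taking [M] to be [L] suffices: elements of [G s] above [L] lie in [P] anyway. *)
have [s' [P' [z [[ss' cP' PP' _] [h1 h2 h3 h4 emb]]]]] :=
  extension 0 L cP Px Py1 Py2 Pt lo0 lo1 hix hiy lohi.
exists s', P'; split=> //; first exact: ltnW.
- move=> w Gw P'w; have [le|lt] := lerP w L; last by apply: PL => //; apply: ltW.
  by apply: (emb 0%N); rewrite ?mulr0 ?addr0 //; left.
- by move=> *; exists z.
Qed.

(** * The sequence of stages and the chain of their [top] elements *)

Record stage := Stage { level : nat; cone : rat -> Prop; top : rat }.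

Definition good_stage (S : stage) : Prop :=
  [/\ stage_cone (level S) (cone S), cone S 1 & cone S (top S)].

(** [xyy k] is the refinement problem treated at step [k]. The clause on multiples of [top] is
    limited to [n <= k] since one adjoined element of finite order protects only boundedly many
    coefficients; a descent for a given [n] therefore stops at stage [n]. *)
Definition next_stage (xyy : nat -> rat * (rat * rat)) (k : nat) (S S' : stage) : Prop :=
  [/\ (level S < level S')%N,
      (forall p, cone S p -> cone S' p),
      cone S' (top S' - top S),
      top S + 1 <= top S' &
      (forall n z, (n <= k)%N -> cone S' (top S' * n%:R - z%:R) -> cone S (top S * n%:R - z%:R)) ]
  /\ splits (cone S) (cone S') (xyy k).1 (xyy k).2.1 (xyy k).2.2.

Lemma next_stage_exists xyy k S : good_stage S -> exists S', good_stage S' /\ next_stage xyy k S S'.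
Proof.
case: S => s P d [/= cP P1 Pd].
have [s1 [P1' [ss1 cP1 PP1 emb1 sp]]] := refine_step (xyy k).1 (xyy k).2.1 (xyy k).2.2 cP.
have [Q0 QD QG _] := cP1.
have Q2 : P1' (1 + 1) by apply: QD; apply: PP1.
have Q22 : P1' (1 + 1 + (1 + 1) - (1 + 1)) by rewrite addrK.
(* Here [x = y1 = y2 = 2] and [lo = 1], so the new elements are [z] and [2 - z] with [1 < z]. The
   lower bound makes [top] grow by at least 1; positivity of [2 - z] gives the bound [(d + 2) * k]
   on the elements to be pulled back. *)
have [s' [P' [z [[s1s' cP' PP' zlo] [h1 h2 _ _ emb2]]]]] :
    exists s' P' z, [/\ (s1 < s')%N, stage_cone s' P', (forall p, P1' p -> P' p) & 1 < z] /\
    [/\ P' z, P' (1 + 1 - z), P' (1 + 1 - z), P' (1 + 1 - (1 + 1) + z) &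
      forall n w, (n <= k)%N -> n = 0%N \/ 1 + 1 = 1 + 1 :> rat -> G s1 w ->
        w + z * n%:R <= (d + 2%:R) * k%:R ->
        P' (w + z * n%:R) -> P1' w].
  by apply: (extension (hi := 1 + 1)) => //; lra.
have [P'0 P'D P'G _] := cP'.
have [Gd d0] := (let: And4 _ _ H _ := cP in H) _ Pd.
have [_ z2] := P'G _ h2.
exists (Stage s' P' (d + z)); split; first split=> //=.
- by apply/PP'/PP1.
- by apply: P'D => //; apply/PP'/PP1.
split=> [|x y1 y2 t]; first split=> /=.
- exact: leq_ltn_trans ss1 s1s'.
- by move=> p /PP1/PP'.
- by rewrite addrC addKr.
- by lra.
- move=> n u nk.
  have -> : (d + z) * n%:R - u%:R = d * n%:R - u%:R + z * n%:R by ring.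
  have Gw : G s (d * n%:R - u%:R) by apply: GB; [apply: GM | apply: G_nat].
  move=> Hw; apply: emb1 => //; apply: (emb2 n) => //; [by right| exact: G_mono Gw |].
  have -> : d * n%:R - u%:R + z * n%:R = (d + z) * n%:R - u%:R by ring.
  have : (d + z) * n%:R <= (d + 2%:R) * k%:R.
    by apply: ler_pM; rewrite ?ler0n ?ler_nat //; lra.
  by have := ler0n rat u; lra.
- by have [x1 [? ? ? ?]] := sp x y1 y2 t; exists x1; split; apply: PP'.
Qed.

Lemma stage_sequence xyy : exists f : nat -> stage,
  top (f 0%N) = 0 /\ forall k, good_stage (f k) /\ next_stage xyy k (f k) (f k.+1).
Proof.
pose P0 q := G 0 q /\ 0 <= q.
have g0 : good_stage (Stage 0 P0 0).
  have P0n n : P0 n%:R by split; [apply: G_nat | apply: ler0n].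
  split=> /=; [split|exact: (P0n 1%N)|exact: (P0n 0%N)] => //.
  - exact: (P0n 0%N).
  - by move=> x y [Gx x0] [Gy y0]; split; [apply: GD | apply: addr_ge0].
  - by exists 0.
have [f [f0 Hf]] := dependent_choice g0 (next_stage_exists xyy).
by exists f; rewrite f0.
Qed.

(** * The union of the cones *)

Section Limit.
Variables (f : nat -> stage) (xyy : nat -> rat * (rat * rat)).
Hypothesis top0 : top (f 0%N) = 0.
Hypothesis good : forall k, good_stage (f k).
Hypothesis next : forall k, next_stage xyy k (f k) (f k.+1).

Definition limit_cone (q : rat) : Prop := exists k, cone (f k) q.

Lemma cone_mono j k p : (j <= k)%N -> cone (f j) p -> cone (f k) p.
Proof.
elim: k => [|k IH]; first by rewrite leqn0 => /eqP ->.
by rewrite leq_eqVlt => /predU1P[-> //|jk] Pp; case: (next k) => -[_ sub _ _ _] _; apply/sub/IH.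
Qed.

Lemma level_ge k : (k <= level (f k))%N.
Proof. by elim: k => // k IH; case: (next k) => -[lt _ _ _ _] _; apply: leq_ltn_trans lt. Qed.

Lemma top_mono j k : (j <= k)%N -> cone (f k) (top (f k) - top (f j)).
Proof.
have P0 i : cone (f i) 0 by case: (good i) => -[].
elim: k => [|k IH]; first by rewrite leqn0 => /eqP ->; rewrite subrr.
rewrite leq_eqVlt => /predU1P[->|jk]; first by rewrite subrr.
case: (next k) => -[_ sub inc _ _] _; case: (good k.+1) => -[_ PD _ _] _ _.
by rewrite -(subrKA (top (f k))); apply: PD => //; apply/sub/IH.
Qed.

Lemma top_ge k : k%:R <= top (f k).
Proof.
elim: k => [|k IH]; first by rewrite top0.
by case: (next k) => -[_ _ _ inc _] _; rewrite -natr1; lra.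
Qed.

Lemma cone_nat k n : cone (f k) n%:R.
Proof.
by case: (good k) => cP P1 _; have := coneM n cP P1; rewrite mul1r.
Qed.

Lemma limit_coneD x y : limit_cone x -> limit_cone y -> limit_cone (x + y).
Proof.
move=> [j xj] [k yk]; exists (maxn j k); case: (good (maxn j k)) => -[_ PD _ _] _ _.
by apply: PD; [apply: cone_mono xj; apply: leq_maxl | apply: cone_mono yk; apply: leq_maxr].
Qed.

Lemma limit_cone_ge0 x : limit_cone x -> 0 <= x.
Proof. by case=> k; case: (good k) => -[_ _ PG _] _ _ /PG[]. Qed.

Lemma limit_cone_level x : limit_cone x -> exists s, G s x.
Proof. by case=> k; case: (good k) => -[_ _ PG _] _ _ /PG[? _]; exists (level (f k)). Qed.

(* [n * top (f k) - N] can only be positive if [n * top (f n) - N] is. *)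
Lemma not_below_top n : exists N : nat, forall k, ~ limit_cone (top (f k) * n%:R - N%:R).
Proof.
pose N := (Num.truncn (top (f n) * n%:R)).+1.
have topN : top (f n) * n%:R < N%:R by apply: truncnS_gt.
have desc k : (n <= k)%N -> cone (f k) (top (f k) * n%:R - N%:R) -> False.
  elim: k => [|k IH].
    rewrite leqn0 => /eqP n0; case: (good 0%N) => -[_ _ PG _] _ _ /PG[_].
    by move: topN; rewrite n0; lra.
  rewrite leq_eqVlt => /predU1P[<-|nk].
    by case: (good n) => -[_ _ PG _] _ _ /PG[_]; lra.
  by case: (next k) => -[_ _ _ _ back] _ /(back n N nk)/(IH nk).
exists N => k [j Pj]; apply: (desc (maxn n (maxn j k))); first exact: leq_maxl.
set i := maxn n _.
have ji : (j <= i)%N by rewrite /i !leq_max leqnn orbT.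
have ki : (k <= i)%N by rewrite /i !leq_max leqnn !orbT.
(* Replacing [k] by the later index [i] adds a multiple of a positive difference of tops, so
   positivity moves to a stage where [desc] applies. *)
have -> : top (f i) * n%:R - N%:R = (top (f k) * n%:R - N%:R) + (top (f i) - top (f k)) * n%:R by ring.
case: (good i) => cP _ _; have [_ PD _ _] := cP.
by apply: PD; [apply: cone_mono Pj | apply: coneM cP (top_mono ki)].
Qed.
End Limit.

(** * The simple Riesz group and its interval, for an abstract tower *)

Lemma rank_one_riesz_group :
  exists (U : zmodType) (P : U -> Prop),
    [/\ po_cone P /\ simple_pog P, riesz P, rank_one U,
        (exists D : U -> Prop,
           [/\ is_interval P D, unbounded P D, countably_generated P D &
               forall n : nat, (0 < n)%N -> ~ (forall z, multD P D n z <-> P z)]) &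
        exists phi : U -> rat, [/\ additive_map phi, injective phi &
             forall q, (exists s, G s q) <-> exists x, phi x = q]].
Proof.
(* Every triple recurs infinitely often, so each refinement problem is met again after all its data
   have become positive. *)
have [xyy xyyP] := @exists_recurrent_enumeration (rat * (rat * rat))%type (0, (0, 0)).
have [f [top0 Hf]] := stage_sequence xyy.
have good k := (Hf k).1; have next k := (Hf k).2.
have [U [phi [inj im]]] : exists (U : zmodType) (phi : {additive U -> rat}),
    injective phi /\ forall q, (exists s, G s q) <-> exists x, phi x = q.
  apply: subgroup_zmodType; first by exists 0%N; apply: (G_nat 0 0).
  move=> x y [s Gx] [t Gy]; exists (maxn s t).
  by apply: GB; [apply: G_mono Gx; apply: leq_maxl | apply: G_mono Gy; apply: leq_maxr].
have Gphi x : exists k, G (level (f k)) (phi x).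
  have [s Gs] : exists s, G s (phi x) by apply/im; exists x.
  by exists s; apply: G_mono Gs; apply: level_ge next s.
pose P x := limit_cone f (phi x).
have mono := cone_mono next.
have PD x y : P x -> P y -> P (x + y).
  by move=> Px Py; rewrite /P raddfD; apply: (limit_coneD good next).
have P_lift q : limit_cone f q -> exists2 x, P x & phi x = q.
  move=> Pq; have /im[x defq] := limit_cone_level good Pq.
  by exists x => //; rewrite /P defq.
have P0 : P 0 by exists 0%N; rewrite raddf0; case: (good 0%N) => -[].
have phiMn x n : phi (x *+ n) = phi x * n%:R by rewrite raddfMn /= mulr_natr.
have Pnat n : limit_cone f n%:R by exists 0%N; apply: (cone_nat good).
have [one P1 one1] := P_lift _ (Pnat 1%N).
have unit u : P u -> u != 0 -> order_unit P u.
  move=> Pu uN0; split=> // x.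
  have u0 : 0 < phi u.
    rewrite lt_neqAle (limit_cone_ge0 good Pu) andbT eq_sym.
    by apply: contra uN0 => /eqP e; apply/eqP/inj; rewrite e raddf0.
  have [k Gk] := Gphi u; have [j Gj] := Gphi x.
  pose i := maxn k j.
  have le_lvl l : (l <= i)%N -> (level (f l) <= level (f i))%N.
    elim: (i) => [|i' IH]; first by rewrite leqn0 => /eqP ->.
    rewrite leq_eqVlt => /predU1P[->//|li].
    by case: (next i') => -[lt _ _ _ _] _; apply: ltnW; apply: leq_ltn_trans lt; apply: IH.
  have [[_ _ _ [L PL]] _ _] := good i.
  (* Both elements live at stage [i], whose cone contains everything above [L]; [n] is chosen so
     that [n * phi u - phi x] exceeds [L]. *)
  pose n := (Num.truncn `|(L + phi x) / phi u|).+1.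
  have nP : L + phi x < phi u * n%:R.
    rewrite mulrC -ltr_pdivrMr //.
    by apply: le_lt_trans (ler_norm _) (truncnS_gt _).
  exists n; exists i; rewrite raddfB phiMn; apply: PL; last by lra.
  apply: GB; last by apply: G_mono Gj; apply/le_lvl/leq_maxr.
  by apply: GM; apply: G_mono Gk; apply/le_lvl/leq_maxl.
have exT k : exists x, P x /\ phi x = top (f k).
  have [|x Px e] := P_lift (top (f k)); last by exists x.
  by exists k; case: (good k).
pose T k := sval (constructive_indefinite_description _ (exT k)).
have TP k : P (T k) /\ phi (T k) = top (f k).
  exact: (svalP (constructive_indefinite_description _ (exT k))).
have Tmono j k : (j <= k)%N -> P (T k - T j).
  move=> jk; rewrite /P raddfB (TP j).2 (TP k).2; exists k.
  exact: (top_mono good next).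
pose D x := P x /\ exists k, P (T k - x).
have D_le n (xs : 'I_n -> U) : (forall i, D (xs i)) ->
    exists k, P (T k *+ n - \sum_(i < n) xs i).
  elim: n xs => [|n IH] xs Dxs; first by exists 0%N; rewrite big_ord0 subr0.
  have [//|j Pj] := IH (fun i => xs (widen_ord (leqnSn n) i)).
  have [_ [k Pk]] := Dxs ord_max.
  exists (maxn j k); rewrite big_ord_recr /= mulrSr.
  set S := \sum_(i < n) _ in Pj *; set y := xs _ in Pk *; set i := maxn j k.
  have -> : T i *+ n + T i - (S + y) = (T j *+ n - S) + (T i - T j) *+ n + ((T k - y) + (T i - T k)).
    by rewrite mulrnBl opprD; apply: inj; rewrite !raddfD !raddfN /=; ring.
  have PMn x m : P x -> P (x *+ m).
    by move=> Px; elim: m => [|m IHm]; rewrite ?mulr0n // mulrS; apply: PD.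
  apply: (PD); apply: (PD) => //; last by apply/Tmono/leq_maxr.
  by apply/PMn/Tmono/leq_maxl.
exists U, P; split.
- split; split=> //.
  + split=> // x Px PNx; apply: inj; rewrite raddf0; apply/eqP.
    rewrite eq_le (limit_cone_ge0 good Px) andbT -oppr_ge0 -raddfN.
    exact: (limit_cone_ge0 good PNx).
  + by exists one; apply/eqP => e; move: one1; rewrite e raddf0.
- move=> x y1 y2 Px Py1 Py2 Pt.
  have [kx Hx] := Px; have [k1 H1] := Py1; have [k2 H2] := Py2; have [kt Ht] := Pt.
  have [k [kK ek]] := xyyP (phi x, (phi y1, phi y2)) (maxn (maxn kx kt) (maxn k1 k2)).
  move: kK; rewrite !geq_max => /andP[/andP[kxk ktk] /andP[k1k k2k]].
  case: (next k) => _; rewrite ek /= => sp.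
  have [] := sp (mono _ _ _ kxk Hx) (mono _ _ _ k1k H1) (mono _ _ _ k2k H2).
    by rewrite -raddfD -raddfB; apply: (mono _ _ _ ktk Ht).
  move=> r [Cr Cxr Cy1r Cy2r].
  have [u Pu ur] := P_lift r (ex_intro _ k.+1 Cr).
  exists u, (x - u); split=> //; last by rewrite addrC subrK.
  + by exists k.+1; rewrite raddfB ur.
  + by exists k.+1; rewrite raddfB ur.
  + by exists k.+1; rewrite raddfB [phi (x - u)]raddfB ur opprB addrA addrAC.
- exists phi; split; first exact: raddfD.
  by split=> //; exists one; rewrite one1.
- exists D; split.
  + split.
    * by exists 0; split=> //; exists 0%N; rewrite subr0; case: (TP 0%N).
    * by move=> x [].
    * move=> x y [Px [j xj]] [Py [k yk]]; exists (T (maxn j k)).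
      have low z l : P (T l - z) -> (l <= maxn j k)%N -> P (T (maxn j k) - z).
        by move=> Pz /Tmono Pl; rewrite -(subrKA (T l)); apply: PD.
      split; [|exact: low xj (leq_maxl _ _)|exact: low yk (leq_maxr _ _)].
      by split; [case: (TP (maxn j k)) | exists (maxn j k); rewrite subrr].
    * move=> x y Py yx [Px [k xk]]; split=> //; exists k.
      by rewrite -(subrKA x); apply: PD.
  + exists one; split; first by apply: unit => //; apply/eqP => e; move: one1; rewrite e raddf0.
    move=> s [sD [_ s1]] M.
    have sMn x n : s (x *+ n) = Rmult (INR n) (s x).
      elim: n => [|n IH].
        by rewrite mulr0n Rmult_0_l; apply: (Rplus_eq_reg_l (s 0)); rewrite -sD addr0 Rplus_0_r.
      by rewrite mulrS sD IH S_INR; ring_simplify.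
    have [k Mk] := INR_unbounded M.
    exists (T k); split; first by split; [case: (TP k) | exists k; rewrite subrr].
    apply: Rlt_le_trans Mk _.
    have d0 : (0 < `|denq (top (f k))|)%N by rewrite absz_gt0 denq_neq0.
    have t0 : 0 <= top (f k) by apply: le_trans (top_ge top0 next k); rewrite ler0n.
    have topE : top (f k) * `|denq (top (f k))|%:R = `|numq (top (f k))|%:R.
      have abs_nat (z : int) : 0 <= z -> `|z|%:R = z%:~R :> rat by case: z.
      by rewrite !abs_nat ?denq_ge0 ?numq_ge0 // -numqE.
    (* Clearing the denominator makes a multiple of [T k] an integer multiple of [one]. Hence
       [s (T k)] is the rational number [top (f k)], which is at least [k]. *)
    have eqT : T k *+ `|denq (top (f k))| = one *+ `|numq (top (f k))|.
      by apply: inj; rewrite !phiMn (TP k).2 one1 mul1r.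
    have le_nd : (k * `|denq (top (f k))| <= `|numq (top (f k))|)%N.
      by rewrite -(ler_nat rat) -topE natrM ler_wpM2r ?ler0n // (top_ge top0 next).
    have d0R := lt_0_INR _ (elimT ssrnat.ltP d0).
    apply: (Rmult_le_reg_l _ _ _ d0R); rewrite -sMn eqT sMn s1 Rmult_1_r.
    by rewrite mulnC in le_nd; rewrite -mult_INR; apply/le_INR/ssrnat.leP.
  + exists T; split; last by move=> x [].
    by move=> k; split; [case: (TP k) | exists k; rewrite subrr].
  (* Otherwise the integer [N] would lie below a sum of [n] members of [D], hence below [T k *+ n]
     for some [k]. *)
  + move=> n _ H; have [N HN] := not_below_top good next n.
    have [z Pz defz] := P_lift _ (Pnat N).
    have [_ [xs [Dxs le]]] := (H z).2 Pz.
    have [k Pk] := D_le n xs Dxs; apply: (HN k).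
    have : P (T k *+ n - z) by rewrite -(subrKA (\sum_(i < n) xs i)); apply: PD.
    by rewrite /P raddfB phiMn defz (TP k).2.
- by exists phi; split=> //; exact: raddfD.
Qed.
End Tower.

(** * Arithmetic of generalized integers and of the groups [Zgen n] *)

Definition exp_le (k : nat) (e : option nat) : Prop := if e is Some j then (k <= j)%N else True.

Lemma exp_leD k j x y : exp_le k x -> exp_le j y -> exp_le (k + j) (eadd x y).
Proof. by case: x y => [x|] [y|] //=; apply: leq_add. Qed.

Lemma exp_leW j k e : (j <= k)%N -> exp_le k e -> exp_le j e.
Proof. by case: e => [e|] //=; apply: leq_trans. Qed.

Lemma gint_of_natE b p : (0 < b)%N -> gint_of_nat b p = Some (logn p b).
Proof. by rewrite /gint_of_nat; case: eqP => // ->. Qed.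

Lemma gdvd_natP b n : (0 < b)%N ->
  gdvd (gint_of_nat b) n <-> forall p, prime p -> exp_le (logn p b) (n p).
Proof.
move=> b0; split=> [[n' dn] p pp|le].
  by rewrite dn // gint_of_natE //; case: (n' p) => [k|] //=; apply: leq_addr.
exists (fun p => omap (fun j => j - logn p b)%N (n p)) => p pp.
by have := le p pp; rewrite gint_of_natE //; case: (n p) => [k|] //= /subnKC ->.
Qed.

Lemma ZgenP n q : Zgen n q <-> exists (u : int) (b : nat),
  [/\ (0 < b)%N, (forall p, prime p -> exp_le (logn p b) (n p)) & q = u%:~R / b%:R].
Proof.
split=> [[u [b [b0 [/gdvd_natP dn ->]]]]|[u [b [b0 le ->]]]]; exists u, b; first by split; auto.
by split=> //; split=> //; apply/gdvd_natP.
Qed.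

Lemma Zgen_int n (u : int) : Zgen n u%:~R.
Proof.
apply/ZgenP; exists u, 1%N; split=> //; last by rewrite divr1.
by move=> p _; rewrite logn1; case: (n p).
Qed.

(** The common denominator is the lcm: its exponents are maxima and stay below those of [n], whereas
    those of the product could exceed them. *)
Lemma ZgenB n x y : Zgen n x -> Zgen n y -> Zgen n (x - y).
Proof.
move=> /ZgenP[u [b [b0 lb ->]]] /ZgenP[v [c [c0 lc ->]]]; apply/ZgenP.
have l0 : (0 < lcmn b c)%N by rewrite lcmn_gt0 b0.
have /dvdnP[b' eb] := dvdn_lcml b c; have /dvdnP[c' ec] := dvdn_lcmr b c.
exists (u * b'%:Z - v * c'%:Z), (lcmn b c); split=> //.
  move=> p pp; rewrite logn_lcm //.
  by rewrite /maxn; case: ifP => _; auto.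
have nz k : (0 < k)%N -> k%:R != 0 :> rat by rewrite pnatr_eq0 lt0n.
have b'0 : (0 < b')%N by move: l0; rewrite eb muln_gt0 => /andP[].
have c'0 : (0 < c')%N by move: l0; rewrite ec muln_gt0 => /andP[].
rewrite rmorphB !rmorphM /= mulrBl {1}eb ec !natrM -!pmulrn.
by congr (_ - _); field; rewrite !nz.
Qed.

Lemma ZgenN n x : Zgen n x -> Zgen n (- x).
Proof. by move=> Zx; rewrite -[- x]add0r; apply: ZgenB => //; apply: (Zgen_int n 0). Qed.

Lemma ZgenD n x y : Zgen n x -> Zgen n y -> Zgen n (x + y).
Proof. by move=> Zx Zy; rewrite -[y]opprK; apply: ZgenB => //; apply: ZgenN. Qed.

Lemma ZgenM n x (u : int) : Zgen n x -> Zgen n (x * u%:~R).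
Proof.
move=> /ZgenP[v [b [b0 lb ->]]]; apply/ZgenP; exists (v * u), b; split=> //.
by rewrite rmorphM /= mulrAC.
Qed.

(** Denominators allowed by [n] are coprime to [N], so Gauss's lemma applies. Thus [1 / N] has order
    exactly [N] modulo [Zgen n], the source of elements of large order. *)
Lemma Zgen_coprime_div n (j : int) (N : nat) : (0 < N)%N ->
  (forall p, prime p -> (p %| N)%N -> n p = Some 0%N) ->
  Zgen n (j%:~R / N%:R) -> (N %| `|j|)%N.
Proof.
move=> N0 cop /ZgenP[u [b [b0 lb e]]].
have cNb : coprime N b.
  rewrite coprime_has_primes //; apply/hasPn => p; rewrite !mem_primes => /and3P[pp _ pb].
  apply/negP => /and3P[_ _ pN]; have := lb p pp.
  by rewrite (cop p pp pN) /= leqn0 eqn0Ngt logn_gt0 mem_primes pp b0 pb.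
have {}e : j * b%:Z = u * N%:Z.
  apply: (@intr_inj rat); rewrite !rmorphM /= -!pmulrn.
  have nz k : (0 < k)%N -> k%:R != 0 :> rat by rewrite pnatr_eq0 lt0n.
  by apply/eqP; rewrite -eqr_div ?nz //; apply/eqP.
rewrite -(Gauss_dvdl _ cNb); have := congr1 absz e; rewrite !abszM /= => ->.
exact: dvdn_mull.
Qed.

Lemma gpsum_recl g p N : gpsum g p N.+1 = eadd (g 0%N p) (gpsum (fun i => g i.+1) p N).
Proof. by rewrite /gpsum /= -[1%N]addn0 iotaDl foldr_map. Qed.

Lemma gpsum_nat (b : nat -> nat) p N : (forall i, (0 < b i)%N) ->
  gpsum (fun i => gint_of_nat (b i)) p N = Some (logn p (\prod_(i < N) b i)).
Proof.
elim: N b => [|N IH] b b0; first by rewrite big_ord0 logn1.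
rewrite gpsum_recl (IH (fun i => b i.+1)) // big_ord_recl gint_of_natE // lognM //.
by apply: prodn_gt0.
Qed.

Lemma gprodP g p k :
  gprod g p = Some k <-> exists N0, forall N, (N0 <= N)%N -> gpsum g p N = Some k.
Proof.
rewrite /gprod; case: excluded_middle_informative => [H|nH]; last first.
  by split=> // H; case: nH; exists k.
case: constructive_indefinite_description => l /= [N1 H1]; split=> [[<-]|[N0 H0]]; first by exists N1.
by rewrite -(H1 _ (leq_maxl N1 N0)) (H0 _ (leq_maxr N1 N0)).
Qed.

(** This covers an infinite first exponent, where all nonempty partial sums are [None]. It serves to
    split off the first two factors of the given product. *)
Lemma gprod_recl g p : gprod g p = eadd (g 0%N p) (gprod (fun i => g i.+1) p).
Proof.
case e: (gprod (fun i => g i.+1) p) => [k|].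
  case e0: (g 0%N p) => [c|] /=.
    have /gprodP[N0 H] := e; apply/gprodP; exists N0.+1 => -[//|N] ltN.
    by rewrite gpsum_recl H // e0.
  case e': (gprod g p) => [l|] //; have /gprodP[N0 H] := e'.
  by have := H N0.+1 (leqnSn _); rewrite gpsum_recl e0.
have -> : eadd (g 0%N p) None = None by case: (g 0%N p).
case e': (gprod g p) => [l|] //; have /gprodP[N0 H] := e'.
case e0: (g 0%N p) => [c|]; last by have := H N0.+1 (leqnSn _); rewrite gpsum_recl e0.
suff : gprod (fun i => g i.+1) p = Some (l - c)%N by rewrite e.
apply/gprodP; exists N0 => N leN; have := H N.+1 (leqW leN).
by rewrite gpsum_recl e0; case: gpsum => //= x [<-]; rewrite addKn.
Qed.

(** * The concrete tower with denominators from partial products *)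

Section Denominators.
Variables (b : nat -> nat) (m : gint).
Hypothesis b_gt1 : forall i, (1 < b i)%N.
Let n : gint := gprod (fun i => gint_of_nat (b i)).
Hypothesis cop : gcoprime m n.

Definition denom (s : nat) : nat := \prod_(i < s) b i.

(** The group of all fractions [r / denom s] with [r] in [Zgen m]. *)
Definition Zstage (s : nat) (q : rat) : Prop := Zgen m (q * (denom s)%:R).

Let b_gt0 i : (0 < b i)%N. Proof. exact: ltnW. Qed.

Lemma denom_gt0 s : (0 < denom s)%N. Proof. exact: prodn_gt0. Qed.

Lemma denomS s : denom s.+1 = (denom s * b s)%N.
Proof. by rewrite /denom big_ord_recr. Qed.

Lemma dvdn_denom s t : (s <= t)%N -> (denom s %| denom t)%N.
Proof.
elim: t => [|t IH]; first by rewrite leqn0 => /eqP ->.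
rewrite leq_eqVlt => /predU1P[-> //|st].
by rewrite denomS dvdn_mulr // IH.
Qed.

(** Each factor is at least 2, and [k + 1 <= 2 * k] once [k] is positive. This linear growth makes
    the grids fine and the orders large. *)
Lemma denom_growth s k : (k * denom s <= denom (s + k))%N.
Proof.
elim: k => // k IH; rewrite addnS denomS.
have := denom_gt0 (s + k); have := b_gt1 (s + k); case: k IH => [|k] IH; first by rewrite addn0; nia.
nia.
Qed.

(** A prime dividing one partial product divides all later ones, so its exponent in [n] is not 0 and
    coprimality forces 0 in [m]. *)
Lemma denom_coprime p s : prime p -> (p %| denom s)%N -> m p = Some 0%N.
Proof.
move=> pp pd; have [//|/gprodP[N0 H]] := cop pp.
have := H (maxn s N0) (leq_maxr _ _); rewrite gpsum_nat // => -[] /eqP.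
rewrite eqn0Ngt logn_gt0 mem_primes pp denom_gt0 /=.
by rewrite (dvdn_trans pd) // dvdn_denom ?leq_maxl.
Qed.

Lemma logn_denom_mono p s t : (s <= t)%N -> (logn p (denom s) <= logn p (denom t))%N.
Proof. by move=> st; apply: dvdn_leq_log; [apply: denom_gt0 | apply: dvdn_denom]. Qed.

Lemma logn_denom_le p s : exp_le (logn p (denom s)) (n p).
Proof.
case e: (n p) => [k|] //=; have /gprodP[N0 H] := e.
have := H (maxn s N0) (leq_maxr _ _); rewrite gpsum_nat // => -[<-].
exact: logn_denom_mono (leq_maxl _ _).
Qed.

Lemma logn_denom_cofinal p l : exp_le l (n p) -> exists s, (l <= logn p (denom s))%N.
Proof.
case e: (n p) => [k|] /= lk.
  have /gprodP[N0 H] := e; exists N0.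
  by have := H N0 (leqnn _); rewrite gpsum_nat // => -[->].
elim: {lk} l => [|l [s ls]]; first by exists 0%N.
(* If the exponent never passed that of [denom s], monotonicity would make it eventually constant
   and the exponent in [n] finite. *)
apply: NNPP => no; suff : n p = Some (logn p (denom s)) by rewrite e.
apply/gprodP; exists s => N sN; rewrite gpsum_nat //; congr Some.
apply/eqP; rewrite eqn_leq (logn_denom_mono p sN) andbT leqNgt; apply/negP => lt.
by apply: no; exists N; apply: leq_ltn_trans lt.
Qed.

(** By coprimality the denominator splits prime by prime: each prime power is absorbed either by
    some [denom s] or by [m]. Only primes up to [c] matter, so a single [s] works. *)
Lemma Zgen_union q : Zgen (gmul n m) q <-> exists s, Zstage s q.
Proof.
have nz k : (0 < k)%N -> k%:R != 0 :> rat by rewrite pnatr_eq0 lt0n.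
split=> [/ZgenP[u [c [c0 lc ->]]]|[s /ZgenP[u [c [c0 lc e]]]]]; last first.
  apply/ZgenP; exists u, (denom s * c)%N; split; first by rewrite muln_gt0 denom_gt0.
    move=> p pp; rewrite lognM ?denom_gt0 //; apply: exp_leD; last exact: lc.
    exact: logn_denom_le.
  by rewrite natrM invfM mulrCA -e mulrC mulfK ?nz ?denom_gt0.
pose ok s p := (logn p c <= logn p (denom s))%N \/ exp_le (logn p c) (m p).
have [s sP] : exists s, forall p, (p < c.+1)%N -> prime p -> ok s p.
  elim: c.+1 => [|K [s IH]]; first by exists 0%N.
  suff [t tK] : exists t, prime K -> ok t K.
    exists (maxn s t) => p; rewrite ltnS leq_eqVlt => /predU1P[->|pK] pp.
      case: (tK pp) => [le|]; [left|by right].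
      exact: leq_trans le (logn_denom_mono K (leq_maxr _ _)).
    case: (IH p pK pp) => [le|]; [left|by right].
    exact: leq_trans le (logn_denom_mono p (leq_maxl _ _)).
  have [pK|npK] := boolP (prime K); last by exists 0%N => pK; case/negP: npK.
  have := lc K pK; rewrite /gmul; case: (cop pK) => ->; last first.
    by move=> lk; exists 0%N => _; right; move: lk; case: (m K).
  case nK: (n K) => [k|] /= lk.
    by have [|t tl] := @logn_denom_cofinal K (logn K c); [rewrite nK /= -(addn0 k)|exists t; left].
  by have [|t tl] := @logn_denom_cofinal K (logn K c); [rewrite nK|exists t; left].
(* Multiplying by [denom s] cancels [g] from [c]; what remains of the denominator involves only
   primes where [m] absorbs the power of [c]. *)
exists s; apply/ZgenP; pose g := gcdn c (denom s).
have g0 : (0 < g)%N by rewrite gcdn_gt0 c0.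
have [/dvdnP[c' ec] /dvdnP[d' ed]] : (g %| c)%N /\ (g %| denom s)%N by rewrite dvdn_gcdl dvdn_gcdr.
have c'0 : (0 < c')%N by move: c0; rewrite ec muln_gt0 => /andP[].
exists (u * d'%:Z), c'; split=> //; last first.
  rewrite {1}ec {1}ed !natrM rmorphM /= -pmulrn.
  by rewrite invfM; have := nz _ g0; set G := g%:R => G0; field; rewrite G0 nz.
move=> p pp.
have lcE : logn p c = (logn p c' + logn p g)%N by rewrite {1}ec lognM.
have [pc|cp] := ltnP p c.+1; last first.
  have -> : logn p c' = 0%N by have := ltn_log0 cp; rewrite lcE; lia.
  by case: (m p).
have [le|] := sP p pc pp; last by apply: exp_leW; rewrite lcE leq_addr.
have lg : logn p g = logn p c by rewrite /g logn_gcd ?denom_gt0 //; apply/minn_idPl.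
have -> : logn p c' = 0%N by move: lcE; rewrite lg; clear; lia.
by case: (m p).
Qed.

(** Take [z = (i + 1/N) / denom s1] with [N = denom s2 / denom s1] greater than [T]. Modulo
    [Zstage s1], which contains [Zstage s], this is [1/N] scaled by [denom s1], of order [N] because
    [N] is coprime to [m]. *)
Lemma Zstage_large_order s T (lo hi : rat) : lo < hi ->
  exists s' z, [/\ (s < s')%N, Zstage s' z, lo < z, z < hi & large_order (Zstage s) T z].
Proof.
move=> lohi.
have nz t : (denom t)%:R != 0 :> rat by rewrite pnatr_eq0 -lt0n denom_gt0.
(* The index [s1] makes two steps of the grid of mesh [1 / denom s1] shorter than [hi - lo]: one
   step rounds [lo] up to a grid point, the other leaves room for [1/N]. *)
pose k := (Num.truncn (2%:R / (hi - lo))).+1; pose s1 := (s + k)%N; pose s2 := (s1 + T.+1)%N.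
have ss1 : (s <= s1)%N by apply: leq_addr.
have D1 : 2%:R < (hi - lo) * (denom s1)%:R.
  rewrite mulrC -ltr_pdivrMr ?subr_gt0 //; apply: lt_le_trans (truncnS_gt _) _.
  by rewrite ler_nat; have := denom_growth s k; have := denom_gt0 s; rewrite -/s1 -/k; nia.
have /dvdnP[N eN] : (denom s1 %| denom s2)%N by apply/dvdn_denom/leq_addr.
have N0 : (0 < N)%N by move: (denom_gt0 s2); rewrite eN muln_gt0 => /andP[].
have TN : (T < N)%N by have := denom_growth s1 T.+1; rewrite -/s2 eN leq_pmul2r ?denom_gt0.
have nN : N%:R != 0 :> rat by rewrite pnatr_eq0 -lt0n.
have [i [i1 i2]] : exists i : int,
    lo * (denom s1)%:R < i%:~R /\ i%:~R <= lo * (denom s1)%:R + 1.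
  exists (Num.floor (lo * (denom s1)%:R) + 1).
  by rewrite floorD1_gt; split=> //; rewrite rmorphD /= lerD2r floor_le.
pose z : rat := (i%:~R + N%:R^-1) / (denom s1)%:R.
have zE : z * (denom s1)%:R = i%:~R + N%:R^-1 by rewrite divfK.
have d10 : 0 < (denom s1)%:R :> rat by rewrite ltr0n denom_gt0.
have N1 : 0 < N%:R^-1 :> rat by rewrite invr_gt0 ltr0n.
have N2 : N%:R^-1 <= 1 :> rat by rewrite invf_le1 ?ltr0n // ler1n.
exists s2, z; split.
- by rewrite /s2 addnS ltnS /s1 -addnA leq_addr.
- rewrite /Zstage eN natrM mulrCA zE mulrDr divff //.
  have -> : N%:R * i%:~R + 1 = (N%:Z * i + 1)%:~R :> rat by rewrite intrD intrM.
  exact: Zgen_int.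
- by rewrite -(ltr_pM2r d10) zE; lra.
- by rewrite -(ltr_pM2r d10) zE; lra.
move=> j l Zjl.
have {}Zjl : Zgen m ((z * j%:R - z * l%:R) * (denom s1)%:R).
  have /dvdnP[c ->] := dvdn_denom ss1.
  by rewrite mulnC natrM mulrA; exact: (ZgenM c%:Z Zjl).
have : Zgen m ((j%:Z - l%:Z)%:~R / N%:R).
  have -> : (j%:Z - l%:Z)%:~R / N%:R =
      (z * j%:R - z * l%:R) * (denom s1)%:R - ((j%:Z - l%:Z) * i)%:~R :> rat.
    have -> : (z * j%:R - z * l%:R) * (denom s1)%:R = (j%:R - l%:R) * (z * (denom s1)%:R) by ring.
    by rewrite zE rmorphM rmorphB /= -!pmulrn; ring.
  by apply: ZgenB => //; apply: Zgen_int.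
move/(Zgen_coprime_div N0) => dv.
have {dv} : (N %| `|j%:Z - l%:Z|)%N.
  by apply: dv => p pp pN; apply: (@denom_coprime p s2) => //; rewrite eN dvdn_mulr.
have [->|jl] := eqVneq j l; first by constructor 1.
move/dvdn_leq => /(_ _) le.
have {le} : (N <= `|j%:Z - l%:Z|)%N by apply: le; lia.
move=> le; have [lt|lt] := ltnP j l; [constructor 2|constructor 3]; move: le TN lt; clear; lia.
Qed.
End Denominators.

Theorem theorem5p2 (a : nat -> nat) (Ha : forall n, (a n < a n.+1)%N)
  (m : gint) (Hm : gcoprime m (gprod (fun n => gint_of_nat (a n)))) :
  exists (G : zmodType) (P : G -> Prop),
    [/\ po_cone P /\ simple_pog P, riesz P, rank_one G,
        (exists D : G -> Prop,
           [/\ is_interval P D, unbounded P D, countably_generated P D &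
               forall n : nat, (0 < n)%N -> ~ (forall z, multD P D n z <-> P z)]) &
        (exists nn : gint, gdvd nn (gprod (fun n => gint_of_nat (a n))) /\
           exists f : G -> rat, [/\ additive_map f, injective f &
             forall q, Zgen (gmul nn m) q <-> exists x, f x = q])].
Proof.
(* Strict growth guarantees values at least 2 only from the third term on: [a 0] may be 0 and [a 1]
   may be 1. The two omitted factors form the quotient of the divisibility. *)
pose b i := a i.+2; pose nn := gprod (fun i => gint_of_nat (b i)).
have b1 i : (1 < b i)%N.
  by elim: i => [|i IH]; [have := Ha 0%N; have := Ha 1%N; rewrite /b; lia | apply: ltn_trans IH (Ha _)].
have recl2 p : gprod (fun n => gint_of_nat (a n)) p =
    eadd (gint_of_nat (a 0%N) p) (eadd (gint_of_nat (a 1%N) p) (nn p)).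
  by rewrite 2!gprod_recl.
have dvd : gdvd nn (gprod (fun n => gint_of_nat (a n))).
  exists (fun p => eadd (gint_of_nat (a 0%N) p) (gint_of_nat (a 1%N) p)) => p _.
  rewrite recl2; case: (gint_of_nat (a 0%N) p) (gint_of_nat (a 1%N) p) (nn p) => [x|] [y|] [w|] //=.
  by congr Some; lia.
have cop : gcoprime m nn.
  move=> p pp; case: (Hm p pp) => [|e]; [by left | right].
  move: e; rewrite recl2.
  case: (gint_of_nat (a 0%N) p) (gint_of_nat (a 1%N) p) (nn p) => [x|] [y|] [w|] //= [].
  by move=> e; congr Some; lia.
have [|||||U [P [H1 H2 H3 H4 [phi [H5 H6 H7]]]]] := @rank_one_riesz_group (Zstage b m).
- by move=> s n; rewrite /Zstage -natrM pmulrn; apply: Zgen_int.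
- by move=> s x y; rewrite /Zstage mulrDl; apply: ZgenD.
- by move=> s x; rewrite /Zstage mulNr; apply: ZgenN.
- move=> s t x st; rewrite /Zstage; have /dvdnP[c ->] := dvdn_denom b st.
  by move=> Zx; rewrite mulnC natrM mulrA; exact: (ZgenM c%:Z Zx).
- exact: Zstage_large_order b1 cop.
exists U, P; split=> //; exists nn; split=> //; exists phi; split=> // q.
by rewrite -H7; apply: Zgen_union.
Qed.
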